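(* The rows of Catalan's triangle do not correspond to generalized action graphs. That is, for every integer $n\ge 0$, there is no sequence of generalized action graphs for the $n$-th row of Catalan's triangle, i.e. for the sequence $s_k = C(n,k)$, where $n$ is fixed and $k$ is iterated, $0\le k\le n$.
   Context: Catalan's triangle has entries $C(n,k)=\frac{n-k+1}{n+1}\binom{n+k}{k}$ for integers $n\ge k\ge 0$. Generalized action graphs. Let $s_0,s_1,s_2,\dots$ be a sequence of positive integers (for a row of Catalan's triangle, the finite sequence of its entries). A sequence of generalized action graphs for it is a sequence $G_0,G_1,G_2,\dots$ of directed graphs, one for each term of the sequence, whose vertices are labeled by non-negative integers, such that for every index $m$ of the sequence: (Axiom 1) $G_0$ is the graph with $s_0$ vertices labeled $0$ and no edges. For $m\ge1$, $G_m$ is constructed from $G_{m-1}$ by adding $s_m$ new vertices, each labeled $m$; each new vertex is attached by exactly one new edge, directed from some vertex of $G_{m-1}$ to the new vertex, and no other edges are added (so each connected component is a directed tree rooted at a vertex labeled $0$). (Axiom 2) For every vertex $v$ of $G_m$, the subtree of $G_m$ with root $v$ is isomorphic to $G_j$ for some $j\le m$. Here the subtree with root $v$ is the induced subgraph on $v$ and its descendants (the vertices $w$ for which there is a directed path from $v$ to $w$), and isomorphisms are isomorphisms of directed graphs respecting labels up to adding one constant to all labels. (Axiom 3) Every leaf of $G_m$ (vertex with no outgoing edge) has label $m$.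
   Formalization: The claim is stated for n ≥ 2 instead of n ≥ 0, because rows 0 and 1, namely (1) and (1,1), do have generalized action graphs: a single vertex labeled 0, followed for row 1 by one edge from 0 to 1. *)

(* Defs.v *)
From mathcomp Require Import all_boot all_order all_algebra.
From mathcomp Require Import zify.

Set Implicit Arguments.
Unset Strict Implicit.
Unset Printing Implicit Defensive.

(* For k <= n the division is exact, see [dvdn_catalan_entry]. *)
Definition catalan_entry (n k : nat) : nat :=
  ((n - k + 1) * 'C(n + k, k)) %/ (n + 1).

Definition catalan_row (n : nat) : seq nat :=
  [seq catalan_entry n k | k <- iota 0 n.+1].

Record lgraph := LGraph {
  vert :> finType;
  edge : rel vert;
  label : vert -> nat }.

(* Labels are compared in int, so that the constant may be negative. *)
Definition lgraph_iso (G H : lgraph) : Prop :=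
  exists f : G -> H,
    [/\ bijective f,
        forall x y, edge (f x) (f y) = edge x y
      & exists c : int, forall x, ((label (f x))%:Z = (label x)%:Z + c)%R].

(* [connect] is reflexive, so the root v belongs to its own subtree. *)
Definition subtree (G : lgraph) (v : G) : lgraph :=
  @LGraph {w : G | connect (@edge G) v w}
          (fun x y => edge (val x) (val y))
          (fun x => label (val x)).

Definition initial_graph (s : nat) (G : lgraph) : Prop :=
  [/\ #|G| = s,
      forall x : G, label x = 0
    & forall x y : G, ~~ edge x y].

(* The graph H is obtained from G, identified with its image under f, by
   adding s vertices labeled m, each the target of one new edge, whose source
   is in G, and no other edges. *)
Definition extends_by (m s : nat) (G H : lgraph) : Prop :=
  exists f : G -> H,
    [/\ injective f,
        (forall x y, edge (f x) (f y) = edge x y) /\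
        (forall x, label (f x) = label x),
        #|[set w : H | w \notin codom f]| = s,
        forall w : H, w \notin codom f ->
          label w = m /\ exists u : G, forall x : H, edge x w = (x == f u)
      & forall (w : H) (x : G), w \notin codom f -> ~~ edge w (f x)].

(* Only the graphs G m with m < size s are constrained: they form the sequence
   indexed by the terms of s. *)
Definition generalized_action_graphs (s : seq nat) (G : nat -> lgraph) : Prop :=
  [/\ 0 < size s -> initial_graph (nth 0 s 0) (G 0),
      forall m, m.+1 < size s ->
        extends_by m.+1 (nth 0 s m.+1) (G m) (G m.+1),
      forall m, m < size s -> forall v : G m,
        exists2 j, j <= m & lgraph_iso (subtree v) (G j)
    & forall m, m < size s -> forall v : G m,
        (forall w, ~~ edge v w) -> label v = m].

Lemma dvdn_catalan_entry n k : k <= n ->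
  n + 1 %| (n - k + 1) * 'C(n + k, k).
Proof.
case: k => [|k] le_kn; first by rewrite subn0 dvdn_mulr.
have E := mul_bin_left (n + k.+1) k.
have E2 : n + k.+1 - k = n + 1 by lia.
rewrite E2 in E.
have -> : (n - k.+1 + 1) * 'C(n + k.+1, k.+1)
        = (n + 1) * 'C(n + k.+1, k.+1) - k.+1 * 'C(n + k.+1, k.+1).
  by rewrite -mulnBl; congr (_ * _); lia.
by rewrite E dvdn_sub // dvdn_mulr.
Qed.

(* Rows 0 and 1 of the triangle, (1) and (1, 1), do have generalized action
   graphs, namely the directed paths 0 -> 1 -> ... -> m. Hence nonexistence can
   only hold from row 2 on. *)
Definition path_graph (m : nat) : lgraph :=
  @LGraph 'I_m.+1 (fun i j => j == i.+1 :> nat) (@nat_of_ord m.+1).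

Lemma connect_path_graph m (i j : path_graph m) :
  connect (@edge (path_graph m)) i j = (nat_of_ord i <= nat_of_ord j).
Proof.
apply/idP/idP => [/connectP [p]|].
  elim: p i => [|x p IHp] i /= => [_ -> //|/andP [/eqP exi xp] Ej].
  by apply: leq_trans (IHp _ xp Ej); rewrite exi.
case: j => j ltj /=.
elim: j ltj => [|j IHj] ltj le_ij.
  by rewrite (_ : i = Ordinal ltj) //; apply: val_inj => /=; lia.
have [->|ne_ij] := eqVneq i (Ordinal ltj); first exact: connect0.
have le_ij' : i <= j.
  by move/eqP: ne_ij => ne_ij; have : nat_of_ord i <> j.+1;
     [move=> e; apply: ne_ij; apply: val_inj | lia].
apply: connect_trans (IHj (ltnW ltj) le_ij') _.
by apply: connect1; rewrite /= eqxx.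
Qed.

Lemma generalized_action_graphs_ones k :
  generalized_action_graphs (nseq k 1) path_graph.
Proof.
split; rewrite size_nseq.
- by move=> k0; rewrite nth_nseq k0; split=> [|[[|//] ?]|[[|//] ?] [[|//] ?]] //;
     rewrite card_ord.
- move=> m ltm; rewrite nth_nseq ltm.
  pose f (i : 'I_m.+1) : 'I_m.+2 := widen_ord (leqnSn _) i.
  have codomf w : (w \notin codom f) = (w == ord_max).
    apply/idP/eqP => [wf|->].
      apply: val_inj => /=; apply/eqP; rewrite eqn_leq -ltnS ltn_ord leqNgt /=.
      apply/negP => ltw; case/negP: wf; apply/codomP.
      by exists (Ordinal ltw); apply: val_inj.
    by apply/codomP => -[x /(congr1 val) /= e]; have := ltn_ord x; lia.
  exists f; split=> //=.
  + by move=> x y /(congr1 val) /= e; apply: val_inj.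
  + rewrite (_ : [set w | _] = [set ord_max]) ?cards1 //.
    by apply/setP => w; rewrite inE in_set1 codomf.
  + move=> w; rewrite codomf => /eqP ->; split=> //.
    by exists ord_max => x; rewrite -val_eqE /= eqSS eq_sym.
  + by move=> w x; rewrite codomf => /eqP -> /=; have := ltn_ord x; lia.
- move=> m ltm v; exists (m - v); first by rewrite leq_subr.
  have ltf (x : subtree v) : val x - v < (m - v).+1.
    by have := ltn_ord (val x); have := ltn_ord v; lia.
  have geP (x : subtree v) : v <= val x.
    by rewrite -connect_path_graph (valP x).
  have ltg (y : 'I_(m - v).+1) : y + v < m.+1.
    by have := ltn_ord y; have := ltn_ord v; lia.
  have geg y : connect (@edge (path_graph m)) v (Ordinal (ltg y)).
    by rewrite connect_path_graph leq_addl.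
  exists (fun x => Ordinal (ltf x)); split=> [|x y|].
  + exists (fun y => Sub (Ordinal (ltg y)) (geg y)) => [x|y].
      by apply: val_inj; apply: val_inj; rewrite SubK /= subnK // geP.
    by apply: val_inj => /=; rewrite addnK.
  + have := geP x; have := geP y; rewrite /=; lia.
  + by exists (- Posz v)%R => x; have := geP x; rewrite /=; lia.
- move=> m ltm v noedge /=; apply/eqP; rewrite eqn_leq -ltnS ltn_ord leqNgt /=.
  by apply/negP => ltv; case/negP: (noedge (inord v.+1)); rewrite /= inordK.
Qed.

Corollary generalized_action_graphs_row_le1 n : n <= 1 ->
  generalized_action_graphs (catalan_row n) path_graph.
Proof.
move=> le_n1; have -> : catalan_row n = nseq n.+1 1.
  by case: n le_n1 => [|[|//]].
exact: generalized_action_graphs_ones.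
Qed.

(* Main.v *)
Require Import Defs.
From mathcomp Require Import all_boot.
From mathcomp Require Import zify.

(** Let s be the sequence and suppose that s_0, s_1, s_2 exist. A vertex v of
    G_2 labeled 1 is not a leaf (Axiom 3), so its subtree is not a copy of G_0,
    hence by Axiom 2 has at least #|G_1| = s_0 + s_1 vertices. All of them
    except v are children of v labeled 2, and distinct v have disjoint sets of
    children, so s_1 (s_0 + s_1 - 1) <= s_2. For the n-th row of Catalan's
    triangle this reads n^2 <= (n - 1)(n + 2)/2, which is false. *)

(** A new target [x] has its only parent in the image of [f], so that parent cannot be the new
    vertex [w]. *)
Lemma extension_new_leaf (m : nat) (G H : lgraph) (f : G -> H) :
    (forall w : H, w \notin codom f ->
      label w = m /\ exists u : G, forall x : H, edge x w = (x == f u)) ->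
    (forall (w : H) (x : G), w \notin codom f -> ~~ edge w (f x)) ->
  forall w x : H, w \notin codom f -> ~~ edge w x.
Proof.
move=> new old w x wN; have [/codomP[y ->]|xN] := boolP (x \in codom f).
  exact: old.
have [_ [u ->]] := new x xN.
by apply: contra wN => /eqP ->; apply: codom_f.
Qed.

Lemma card_new (G H : lgraph) (f : G -> H) :
  injective f -> #|H| = #|G| + #|[set w : H | w \notin codom f]|.
Proof.
move=> injf; rewrite -(card_codom injf) -(cardC (mem (codom f))).
by congr (_ + _); apply: eq_card => w; rewrite !inE.
Qed.

Lemma lgraph_iso_card (G H : lgraph) : lgraph_iso G H -> #|G| = #|H|.
Proof. by case=> f [bijf _ _]; apply: bij_eq_card bijf. Qed.

(** A path from [v] stops after at most one edge, so every descendant is [v] itself or a child of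
    [v]. *)
Lemma card_subtree_star (G : lgraph) (v : G) :
    (forall x y : G, edge v x -> ~~ edge x y) ->
  #|subtree v| <= #|[set w : G | edge v w]|.+1.
Proof.
move=> leaf; rewrite card_sig; set A := [set w | _].
apply: leq_trans (_ : #|v |: A| <= _); last by rewrite cardsU1; case: (_ \notin _).
apply/subset_leq_card/subsetP => w; rewrite !inE => /connectP[[|x p] /=].
  by move=> _ ->; rewrite eqxx.
case/andP=> vx; case: p => [|y p] /=; first by move=> _ ->; rewrite vx orbT.
by rewrite (negPf (leaf _ _ vx)).
Qed.

Lemma generalized_action_graphs_growth (s : seq nat) (G : nat -> lgraph) :
    2 < size s -> generalized_action_graphs s G ->
  nth 0 s 1 * (nth 0 s 0 + nth 0 s 1 - 1) <= nth 0 s 2.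
Proof.
move=> s3 [init ext sub leaf].
have [card0 _ edge0] := init (ltn_trans (isT : 0 < 2) s3).
have [f [injf _ cardf newf oldf]] := ext 0 (ltn_trans (isT : 1 < 2) s3).
have [g [injg [edgeg labelg] cardg newg oldg]] := ext 1 s3.
have leaff := @extension_new_leaf _ _ _ _ newf oldf.
have leafg := @extension_new_leaf _ _ _ _ newg oldg.
have cardG1 : #|G 1| = nth 0 s 0 + nth 0 s 1.
    by rewrite (card_new _ _ _ injf) card0 cardf.
have childN u x : u \notin codom f -> edge (g u) x -> x \notin codom g.
  move=> uN; apply: contraL => /codomP[y ->].
  by rewrite edgeg; apply: leaff.
have children u : u \notin codom f ->
    nth 0 s 0 + nth 0 s 1 - 1 <= #|[set w | edge (g u) w]|.
  move=> uN; rewrite leq_subLR add1n.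
  apply: leq_trans (card_subtree_star _ (g u) _); last first.
    by move=> x y ux; apply: leafg; apply: childN ux.
  have [j le_j2 iso] := sub 2 s3 (g u).
  rewrite (lgraph_iso_card _ _ iso) -cardG1.
  (* The case j = 1 is an equality, and for j = 2 the graph [G 2] contains a copy of [G 1]. It
     remains to exclude j = 0. *)
  case: j le_j2 iso => [|[|[|//]]] _ iso //; last first.
    by rewrite (card_new _ _ _ injg) leq_addr.
  (* Otherwise [g u] would be a leaf of [G 2] labeled 1, against Axiom 3. *)
  have /existsP[w uw] : [exists w, edge (g u) w].
    apply: contraT; rewrite negb_exists => /forallP noedge.
    have := leaf 2 s3 (g u) noedge.
    by rewrite labelg (newf _ uN).1.
  (* The isomorphism [h] would carry the edge from [g u] to [w] to an edge of [G 0]. *)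
  case: iso => h [_ edgeh _].
  pose a : subtree (g u) := Sub (g u) (connect0 _ _).
  pose b : subtree (g u) := Sub w (connect1 uw).
  by have := edge0 (h a) (h b); rewrite edgeh /= uw.
(* Double counting of the edges from vertices labeled 1 to vertices labeled 2, first by source and
   then by target. *)
rewrite -{1}cardf -cardg -sum_nat_const.
apply: leq_trans (_ : \sum_(u in [set u | u \notin codom f])
                        #|[set w | edge (g u) w]| <= _).
  by apply: leq_sum => u; rewrite inE; apply: children.
under eq_bigr do rewrite -sum1_card.
rewrite (exchange_big_dep (mem [set w | w \notin codom g])) /=; last first.
  by move=> u w; rewrite !inE; apply: childN.
rewrite -sum1_card; apply: leq_sum => w; rewrite inE => wN.
have [_ [v parent]] := newg w wN.
(* The only parent of [w] is [g v], and [g] is injective, so [w] is counted for at most one [u]. *)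
rewrite sum1_card; apply: leq_trans (_ : #|pred1 v| <= 1); last by rewrite card1.
apply/subset_leq_card/subsetP => u.
by rewrite inE => /andP[_]; rewrite !inE parent (inj_eq injg).
Qed.

Lemma nth_catalan_row (n k : nat) :
  k <= n -> nth 0 (catalan_row n) k = catalan_entry n k.
Proof. by move=> le_kn; rewrite (nth_map 0) ?size_iota // nth_iota. Qed.

Lemma catalan_entry0 (n : nat) : catalan_entry n 0 = 1.
Proof. by rewrite /catalan_entry bin0 subn0 muln1 divnn addn1. Qed.

Lemma catalan_entry1 (n : nat) : 0 < n -> catalan_entry n 1 = n.
Proof. by move=> n0; rewrite /catalan_entry bin1 subnK // mulnK // addn1. Qed.

Lemma catalan_entry2_lt (n : nat) : 1 < n -> catalan_entry n 2 < n * n.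
Proof.
move=> n1; rewrite /catalan_entry ltn_divLR ?addn1 //.
(* [E] is $(n+2)(n+1) = 2\binom{n+2}{2}$; doubling both sides of the goal then removes the
   binomial. *)
have := mul_bin_diag n.+2 1; rewrite bin1 addn2 /= => E.
case: n n1 E => [|[|n]] // _ E.
rewrite subSS subSS subn0 -(ltn_pmul2l (isT : 0 < 2)) mulnCA -E.
nia.
Qed.

Theorem proposition3p5 (n : nat) (hn : 2 <= n) :
  ~ exists G : nat -> lgraph, generalized_action_graphs (catalan_row n) G.
Proof.
case=> G /generalized_action_graphs_growth.
rewrite size_map size_iota ltnS => /(_ hn).
rewrite !nth_catalan_row ?(ltnW hn) // catalan_entry0 catalan_entry1 ?(ltnW hn) //.
by rewrite addKn leqNgt catalan_entry2_lt.
Qed.
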